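(* Let $(\Omega,\Sigma,\mu)$ be a $\sigma$-finite complete measure space all of whose atoms (if any) are singletons. Let $\varphi,\varphi_1$ be Musielak--Orlicz functions over $(\Omega,\Sigma,\mu)$ and assume that $\operatorname{supp} L^{\varphi_1}=\Omega$. Then $$M(L^{\varphi_1},L^{\varphi})=L^{\varphi\ominus\varphi_1},$$ i.e. the two spaces coincide as sets and their norms are equivalent.
   Context: $L^0$ is the space of ($\mu$-a.e. equivalence classes of) real-valued measurable a.e. finite functions on $\Omega$. $\Omega^c$ and $\Omega^a$ denote the non-atomic part and the purely atomic part of $\Omega$. A Young function is $\psi:[0,\infty)\to[0,\infty]$ with $\psi(0)=0$, $\lim_{u\to\infty}\psi(u)=\infty$, convex on $[0,b_\psi)$ (or on $[0,b_\psi]$ when $\psi(b_\psi)<\infty$), where $b_\psi=\sup\{u\ge 0:\psi(u)<\infty\}$ ($b_\psi=0$ is allowed). A Musielak--Orlicz function over $\Omega$ is $\varphi:\Omega\times[0,\infty)\to[0,\infty]$ such that $\varphi(t,\cdot)$ is a Young function for $\mu$-a.e. $t$ and $\varphi(\cdot,u)$ is measurable for each $u\ge 0$. Put $b_\varphi(t)=\inf\{u\ge 0:\varphi(t,u)=\infty\}$ (with $\inf\emptyset=\infty$) and $\varphi^{-1}(t,u)=\inf\{v\ge 0:\varphi(t,v)>u\}$. The modular is $I_\varphi(x)=\int_\Omega\varphi(t,|x(t)|)\,d\mu(t)$, the Musielak--Orlicz space is $L^\varphi=\{x\in L^0: I_\varphi(\lambda x)<\infty\text{ for some }\lambda>0\}$,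 with norm $\|x\|_\varphi=\inf\{\lambda>0:I_\varphi(x/\lambda)\le 1\}$. Up to a null set, $\operatorname{supp}L^\varphi=\{t\in\Omega:b_\varphi(t)>0\}$; thus $\operatorname{supp}L^{\varphi_1}=\Omega$ means $b_{\varphi_1}(t)>0$ for a.e. $t$. A Banach ideal space is a Banach space $X\subset L^0$ such that $x\in L^0$, $y\in X$, $|x|\le|y|$ a.e. imply $x\in X$ and $\|x\|_X\le\|y\|_X$. For Banach ideal spaces $X,Y$ with $\operatorname{supp}X=\Omega$, the space of pointwise multipliers is $M(X,Y)=\{y\in L^0: xy\in Y\text{ for all }x\in X\}$ with norm $\|y\|_M=\sup_{\|x\|_X\le 1}\|xy\|_Y$. The Young conjugate of $\varphi_1$ with respect to $\varphi$ is the function $\varphi\ominus\varphi_1:\Omega\times[0,\infty)\to[0,\infty]$, $$\varphi\ominus\varphi_1(t,u)=\begin{cases}\sup\{\varphi(t,su)-\varphi_1(t,s):0\le s<b_{\varphi_1}(t)\}&\text{if }t\in\Omega^c,\\ \sup\{\varphi(t,su)-\varphi_1(t,s):0\le s\le\min\{1/\varphi^{-1}(t,\tfrac{1}{\mu(\{t\})}),\tfrac{b_{\varphi_1}(t)}{2}\}\}&\text{if }t\in\Omega^a.\end{cases}$$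
   Formalization: On the atomic part, the bound 1/φ^{-1}(t,1/μ({t})) in the definition of φ⊖φ₁ is replaced by φ₁^{-1}(t,1/μ({t})); with the original bound the identity fails, e.g. for counting measure on ℕ and φ=φ₁=2^{-n}u. *)

(* Defs.v *)
(* MathComp-Analysis development. *)
From HB Require Import structures.
From mathcomp Require Import all_boot all_order all_algebra.
From mathcomp Require Import all_classical all_reals all_analysis.
From mathcomp Require Import measurable_realfun.
Set Implicit Arguments.
Unset Strict Implicit.
Unset Printing Implicit Defensive.
Import Order.TTheory GRing.Theory Num.Theory.
Import numFieldNormedType.Exports.
Local Open Scope classical_set_scope.
Local Open Scope ring_scope.

(* Functions on [0, oo[ are total functions R -> \bar R of which only the
   values at nonnegative reals matter. *)

Section young.
Context {R : realType}.
Local Open Scope ereal_scope.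

Definition young_bound (psi : R -> \bar R) : \bar R :=
  ereal_sup [set u%:E | u in [set u : R | (0 <= u)%R /\ psi u < +oo]].

(* [0, b[, or [0, b] when psi b < +oo, where b = young_bound psi *)
Definition young_domain (psi : R -> \bar R) : set R :=
  [set u | (0 <= u)%R /\ (u%:E < young_bound psi \/
                          (u%:E = young_bound psi /\ psi u < +oo))].

Record young_function (psi : R -> \bar R) : Prop := YoungFunction {
  young_ge0 : forall u : R, (0 <= u)%R -> 0 <= psi u ;
  young0 : psi 0%R = 0 ;
  young_cvgy : psi u @[u --> +oo%R] --> +oo ;
  young_convex : forall u v l : R,
    young_domain psi u -> young_domain psi v -> (0 <= l <= 1)%R ->
    psi (l * u + (1 - l) * v)%R <= l%:E * psi u + (1 - l)%:E * psi v }.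

End young.

Section atoms.
Context d (T : measurableType d) (R : realType).
Variable mu : {measure set T -> \bar R}.
Local Open Scope ereal_scope.

Definition atom (A : set T) : Prop :=
  [/\ measurable A, 0 < mu A &
      forall B, measurable B -> B `<=` A -> mu B = 0 \/ mu (A `\` B) = 0].

(* Sets are identified up to null sets: adding null points to an atom {t}
   gives another atom. *)
Definition atoms_are_singletons : Prop :=
  forall A, atom A -> exists t, [/\ A t, measurable [set t] & mu (A `\ t) = 0].

Definition atomic_part : set T := [set t | atom [set t]].

End atoms.

Section musielak_orlicz.
Context d (T : measurableType d) (R : realType).
Variable mu : {measure set T -> \bar R}.
Implicit Types (phi : T -> R -> \bar R) (x y : {mfun T >-> R}).
Local Open Scope ereal_scope.

Record musielak_orlicz_function phi : Prop := MusielakOrliczFunction {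
  mo_ge0 : forall t (u : R), (0 <= u)%R -> 0 <= phi t u ;
  mo_young : {ae mu, forall t, young_function (phi t)} ;
  mo_measurable : forall u : R, (0 <= u)%R ->
    measurable_fun [set: T] (phi ^~ u) }.

Definition mo_bound phi (t : T) : \bar R :=
  ereal_inf [set u%:E | u in [set u : R | (0 <= u)%R /\ phi t u = +oo]].

Definition mo_inv phi (t : T) (u : \bar R) : \bar R :=
  ereal_inf [set v%:E | v in [set v : R | (0 <= v)%R /\ u < phi t v]].

Definition mo_supp phi : set T := [set t | 0 < mo_bound phi t].

(* As phi t may jump upwards at mo_bound phi t, the integrand can fail to be
   measurable on {t | `|x t| = mo_bound phi t}; \int is then a lower integral. *)
Definition modular phi (x : T -> R) : \bar R := \int[mu]_t phi t `|x t|%R.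

(* L^0 is represented by {mfun T >-> R}; spaces of classes modulo a.e. equality
   are the sets of all representatives of their members. *)

Definition mo_space phi : set {mfun T >-> R} :=
  [set x | exists2 l : R, (0 < l)%R & modular phi (fun t => l * x t)%R < +oo].

Definition mo_norm phi (x : {mfun T >-> R}) : \bar R :=
  ereal_inf [set l%:E | l in
    [set l : R | (0 < l)%R /\ modular phi (fun t => x t / l)%R <= 1]].

(* The truncation at an atom t is mo_inv phi1 t (1 / mu {t}), the reciprocal of
   the norm of the indicator of {t} in L^phi1, hence the largest value at t of
   an element of the unit ball of L^phi1. It has to be computed from phi1:
   truncating at 1 / mo_inv phi t (1 / mu {t}) instead would break the
   identity M(L^phi1, L^phi) = L^(phi (-) phi1), e.g., for the counting measure
   on nat and phi n u = phi1 n u = 2^-n u, where M is l^oo whereas the conjugate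
   would be 4^-n max(u - 1, 0), whose space contains the sequence n |-> n. *)
Definition mo_conj phi phi1 (t : T) (u : R) : \bar R :=
  if t \in atomic_part mu then
    ereal_sup [set phi t (s * u)%R - phi1 t s | s in
      [set s : R | (0 <= s)%R /\
        s%:E <= mine (mo_inv phi1 t ((mu [set t])^-1))
                       (mo_bound phi1 t / 2%:E)]]
  else
    ereal_sup [set phi t (s * u)%R - phi1 t s | s in
      [set s : R | (0 <= s)%R /\ s%:E < mo_bound phi1 t]].

End musielak_orlicz.

Section multipliers.
Context d (T : measurableType d) (R : realType).
Implicit Types (X Y : set {mfun T >-> R}) (nX nY : {mfun T >-> R} -> \bar R).
Local Open Scope ereal_scope.

Definition multipliers X Y : set {mfun T >-> R} :=
  [set y | forall x, X x -> Y (x * y)%R].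

Definition multiplier_norm X nX nY (y : {mfun T >-> R}) : \bar R :=
  ereal_sup [set nY (x * y)%R | x in [set x | X x /\ nX x <= 1]].

Definition equivalent_norms X nX nY : Prop :=
  exists c C : R, [/\ (0 < c)%R, (0 < C)%R &
    forall x, X x -> c%:E * nX x <= nY x /\ nY x <= C%:E * nX x].

End multipliers.

(* Main.v *)
(* Replacing phi by its left-continuous regularization [lreg phi] makes every
   integrand measurable and changes the norm by a factor of at most 2, as
   [lreg phi u <= phi u <= lreg phi (2 u)]; only the star-shapedness
   [phi (l u) <= l phi u] for [l] in [0, 1] is used.

   The inclusion of L^(phi (-) phi1) into M is Young's inequality
   [phi(s u) <= phi1(s) + (phi (-) phi1)(u)].

   For the converse, a gliding hump argument shows that a multiplier y, after
   rescaling, maps the unit ball of L^phi1 into the unit ball of L^phi.  The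
   supremum defining [phi (-) phi1] is dominated by a supremum over rational s,
   so it is approximated by [phi(s y) - phi1(s)] for measurable functions s.
   Where this difference is positive, the measure [phi1(s) mu] has no atom of
   mass larger than 1, by non-atomicity on the one hand and by the truncation at
   the atoms on the other hand.  If its total mass exceeded 1/2, some set E
   would have mass in [1/2, 1]; then s 1_E lies in the unit ball of L^phi1,
   whereas the modular of 4 y s 1_E exceeds 1. *)
Require Import Defs.
From HB Require Import structures.
From mathcomp Require Import all_boot all_order all_algebra finmap.
From mathcomp Require Import all_classical all_reals all_analysis.
From mathcomp Require Import measurable_realfun.
From mathcomp Require Import ring lra.
Import Order.TTheory GRing.Theory Num.Theory.
Import numFieldNormedType.Exports.
Set Implicit Arguments.
Unset Strict Implicit.
Unset Printing Implicit Defensive.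
Local Open Scope classical_set_scope.
Local Open Scope ring_scope.

(** * Star-shaped functions and their left-continuous regularization *)

Record star_shaped (R : realType) (f : R -> \bar R) : Prop := StarShaped {
  star_ge0 : forall u, 0 <= u -> (0 <= f u)%E ;
  star_le : forall l u, 0 <= l <= 1 -> 0 <= u -> (f (l * u)%R <= l%:E * f u)%E ;
  star_unbounded : forall M : R, exists2 u, 0 <= u & (M%:E < f u)%E }.

Section star_shaped.
Context {R : realType}.
Implicit Types (f : R -> \bar R) (u v l : R).
Local Open Scope ereal_scope.

Lemma star0 f : star_shaped f -> f 0%R = 0.
Proof.
move=> sf; apply/eqP; rewrite eq_le star_ge0// andbT.
have := star_le sf (l := 0%R) (u := 0%R); rewrite mul0r mul0e.
by apply; rewrite ?lexx ?ler01.
Qed.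

Lemma star_homo f u v : star_shaped f -> (0 <= u)%R -> (u <= v)%R -> f u <= f v.
Proof.
move=> sf u0; rewrite le_eqVlt => /predU1P[->//|uv].
have v0 : (0 < v)%R by exact: le_lt_trans uv.
have := star_le sf (l := (u / v)%R) (u := v); rewrite divfK ?gt_eqF// => h.
have uv1 : (u / v <= 1)%R by rewrite ler_pdivrMr// mul1r ltW.
have uv0 : (0 <= u / v)%R by rewrite divr_ge0// ltW.
apply: (@le_trans _ _ ((u / v)%:E * f v)).
  by apply: h; rewrite ?uv0 ?uv1 ?ltW.
rewrite -[leRHS]mul1e lee_wpmul2r ?lee_fin// star_ge0//; exact: ltW.
Qed.

Lemma young_star_shaped f : young_function f -> star_shaped f.
Proof.
move=> yf; split.
- exact: young_ge0.
- move=> l u /andP[l0 l1] u0.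
  have dom w : (0 <= w)%R -> f w < +oo -> young_domain f w.
    move=> w0 fw; split => //.
    have : w%:E <= young_bound f by apply: ereal_sup_ubound; exists w.
    by rewrite le_eqVlt => /predU1P[<-|]; [right|left].
  have f0 := young0 yf.
  have [fu|] := ltP (f u) +oo; last first.
    (* At an infinite value the bound is trivial unless [l = 0], where the convention that 0 times
       [+oo] is 0 matches [f 0 = 0]. *)
    rewrite leye_eq => /eqP fu; rewrite fu.
    move: l0; rewrite le_eqVlt => /predU1P[<-|l0]; first by rewrite mul0r f0 mul0e.
    by rewrite mulry gtr0_sg// mul1e leey.
  have := young_convex yf (dom u u0 fu) (dom 0%R _ _) (l := l).
  by rewrite mulr0 addr0 f0 mule0 adde0; apply => //; rewrite ?ltry ?l0.
- move=> M; have /cvgeyPgt/(_ M) := young_cvgy yf.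
  move=> [B [_ hB]]; exists (Num.max 0 (B + 1))%R; first by rewrite le_max lexx.
  by apply: hB; rewrite lt_max ltrDl ltr01 orbT.
Qed.

Lemma star_shaped_EFin : star_shaped (@EFin R).
Proof.
split=> [u|l u _ _|M]; rewrite ?lee_fin//.
exists (`|M| + 1)%R; first by rewrite addr_ge0.
by rewrite lte_fin (le_lt_trans (ler_norm _))// ltrDl.
Qed.

(** An enumeration of the nonnegative rationals, with repetitions; a number coding no rational gives
    0. *)
Definition nnrat (n : nat) : R :=
  `|ratr (odflt 0%R (choice.unpickle n : option rat))|%R.

Lemma nnrat_ge0 n : (0 <= nnrat n)%R. Proof. exact: normr_ge0. Qed.

Lemma nnrat_dense u v : (0 <= u)%R -> (u < v)%R ->
  exists n, (u < nnrat n < v)%R.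
Proof.
move=> u0 /rat_in_itvoo[q]; rewrite in_itv/= => /andP[uq qv].
exists (choice.pickle q); rewrite /nnrat choice.pickleK/= ger0_norm ?uq//.
exact: le_trans (ltW uq).
Qed.

(** For [f] nonnegative and nondecreasing this is the left limit at [u > 0]. Taking it along
    rationals makes the composition with a measurable function a countable supremum; the default 0
    gives the value 0 at [u = 0]. *)
Definition lreg f u : \bar R :=
  ereal_sup (range (fun n => if (nnrat n < u)%R then f (nnrat n) else 0)).

Lemma lreg_ge0 f u : (forall v, (0 <= v)%R -> 0 <= f v) -> 0 <= lreg f u.
Proof.
move=> f0; apply: (@le_trans _ _ (if (nnrat 0 < u)%R then f (nnrat 0) else 0)).
  by case: ifP => // _; exact/f0/nnrat_ge0.
by apply: ereal_sup_ubound; exists 0%N.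
Qed.

Lemma lreg_leP f u M : 0 <= M ->
  (forall v, (0 <= v < u)%R -> f v <= M) -> lreg f u <= M.
Proof.
move=> M0 h; apply: ge_ereal_sup => _ [n _ <-].
by case: ifP => // nu; apply: h; rewrite nnrat_ge0.
Qed.

Lemma lreg0 f : (forall v, (0 <= v)%R -> 0 <= f v) -> lreg f 0%R = 0.
Proof.
move=> f0; apply/eqP; rewrite eq_le lreg_ge0// andbT.
by apply: lreg_leP => // v /andP[v0]; rewrite ltNge v0.
Qed.

Lemma lreg_le f u : star_shaped f -> (0 <= u)%R -> lreg f u <= f u.
Proof.
move=> sf u0; apply: lreg_leP; first exact: star_ge0.
by move=> v /andP[v0 /ltW vu]; exact: star_homo.
Qed.

Lemma le_lreg f u v : star_shaped f -> (0 <= u)%R -> (u < v)%R ->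
  f u <= lreg f v.
Proof.
move=> sf u0 uv; have [n /andP[un nv]] := nnrat_dense u0 uv.
apply: (@le_trans _ _ (f (nnrat n))); first by apply: star_homo => //; exact: ltW.
by apply: ereal_sup_ubound; exists n => //; rewrite nv.
Qed.

Lemma le_lreg_scale f u l : star_shaped f -> (0 <= u)%R -> (1 < l)%R ->
  f u <= lreg f (l * u)%R.
Proof.
move=> sf; rewrite le_eqVlt => /predU1P[<- _|u0 l1].
  by rewrite star0// lreg_ge0//; exact: star_ge0.
by apply: le_lreg => //; rewrite ?ltW// ltr_pMl.
Qed.

Lemma lreg_homo f u v : (forall w, (0 <= w)%R -> 0 <= f w) -> (u <= v)%R ->
  lreg f u <= lreg f v.
Proof.
move=> f0 uv; apply: ge_ereal_sup => _ [n _ <-].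
case: ifPn => nu; last exact: lreg_ge0.
by apply: ereal_sup_ubound; exists n => //; rewrite (lt_le_trans nu).
Qed.

(** A point [v < l * u] is [l] times [v / l < u], so star-shapedness of [f] applies below the
    supremum. *)
Lemma lreg_star f l u : star_shaped f -> (0 <= l <= 1)%R -> (0 <= u)%R ->
  lreg f (l * u)%R <= l%:E * lreg f u.
Proof.
move=> sf /andP[l0 l1] u0.
have lr0 w : 0 <= lreg f w by apply: lreg_ge0 => ?; exact: star_ge0.
apply: lreg_leP; first by rewrite mule_ge0.
move=> v /andP[v0 vlu].
have l_gt0 : (0 < l)%R.
  rewrite lt_neqAle l0 andbT; apply/eqP => l0'.
  by move: vlu; rewrite -l0' mul0r ltNge v0.
have -> : v = (l * (v / l))%R by rewrite mulrC divfK ?gt_eqF.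
have vl0 : (0 <= v / l)%R by rewrite divr_ge0.
apply: le_trans (star_le sf _ _) _ => //; first by rewrite l0.
rewrite lee_wpmul2l ?lee_fin//.
by apply: le_lreg => //; rewrite ltr_pdivrMr// mulrC.
Qed.

End star_shaped.

(** * Comparison of integrals of possibly nonmeasurable functions *)

Section lower_integral.
Context d (T : measurableType d) (R : realType).
Variable mu : {measure set T -> \bar R}.
Local Open Scope ereal_scope.
Implicit Types f g h : T -> \bar R.
Import HBNNSimple.

(** The integral of [f^\+] is a supremum over simple functions below it; each of these is a.e. below
    [h], where monotonicity for measurable functions applies. *)
Lemma lower_integral_le f h : measurable_fun setT h -> (forall t, 0 <= h t) ->
  {ae mu, forall t, f t <= h t} -> \int[mu]_t f t <= \int[mu]_t h t.
Proof.
move=> mh h0 fh; rewrite integralE.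
apply: (@le_trans _ _ (\int[mu]_t f^\+ t)).
  by rewrite -[leRHS]sube0 leeB//; exact: integral_ge0.
rewrite ge0_integralTE//; apply: ge_ereal_sup => _ [k /= kf <-].
rewrite -integralT_nnsfun; apply: ae_ge0_le_integral => //.
- by move=> t _; rewrite lee_fin.
- exact/measurable_EFinP.
- move: fh; apply: filterS => t fh _; apply: le_trans (kf t) _.
  by rewrite funeposE ge_max fh h0.
Qed.

(** Once [h] is set to 0 on the exceptional null set, every simple function below it is also below
    [g^\+]; the negative part of [g] vanishes a.e. and contributes nothing. *)
Lemma le_lower_integral g h : measurable_fun setT h -> (forall t, 0 <= h t) ->
  {ae mu, forall t, 0 <= g t} -> {ae mu, forall t, h t <= g t} ->
  \int[mu]_t h t <= \int[mu]_t g t.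
Proof.
move=> mh h0 g0 hg; rewrite [leRHS]integralE.
have -> : \int[mu]_t g^\- t = 0.
  apply/eqP; rewrite eq_le integral_ge0// andbT.
  rewrite -[leRHS](integral0 mu setT); apply: lower_integral_le => //.
  by move: g0; apply: filterS => t g0; rewrite funenegE ge_max lexx leeNl oppe0 g0.
rewrite sube0.
have [N [mN N0 sN]] := hg.
rewrite (ge0_negligible_integral mN)// setTD integral_mkcond.
have h'0 : forall t, 0 <= (h \_ (~` N)) t by move=> t; exact: erestrict_ge0.
rewrite !ge0_integralTE//; apply: le_ereal_sup => _ [k /= kh <-].
exists k => //= t; apply: le_trans (kh t) _.
rewrite patchE; case: ifPn => [|_]; last by rewrite funeposE le_max lexx orbT.
rewrite inE => tN; rewrite funeposE le_max; apply/orP; left.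
by apply: contrapT => /(sN t).
Qed.

End lower_integral.

(** * Sets of intermediate mass *)

Section atoms.
Context d (T : measurableType d) (R : realType).
Local Open Scope ereal_scope.

Lemma measure_setD_split (nu : {measure set T -> \bar R}) (E G : set T) :
  measurable E -> measurable G -> G `<=` E -> nu E = nu G + nu (E `\` G).
Proof.
move=> mE mG GE; rewrite -[in LHS](setDUK GE) measureU//.
- exact: measurableD.
- by rewrite setDIK.
Qed.

(* A subset of minimal mass among those of mass at least a is an atom, unless
   its mass is at most 2a. *)
Lemma intermediate_or_atom (nu : {measure set T -> \bar R}) (A : set T) (a : R) :
  measurable A -> (0 < a)%R -> a%:E <= nu A -> nu A < +oo ->
  (exists E, [/\ measurable E, E `<=` A & a%:E <= nu E <= a%:E + a%:E]) \/
  (exists D, [/\ atom nu D, D `<=` A & a%:E + a%:E < nu D]).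
Proof.
move=> mA a0 aA Afin.
have [|noE] := pselect (exists E,
  [/\ measurable E, E `<=` A & a%:E <= nu E <= a%:E + a%:E]); first by left.
right.
pose big E := [/\ measurable E, E `<=` A & a%:E <= nu E].
have bigA : big A by split.
have big_gt E : big E -> a%:E + a%:E < nu E.
  move=> [mE EA aE]; rewrite ltNge; apply/negP => Ea.
  by apply: noE; exists E; rewrite aE Ea.
(* [f (n, E)] nearly minimizes the mass among big subsets of [E]; iterating with errors [1/(n+1)]
   leads to a minimal big set [D]. *)
have [f fP] : exists f : nat * set T -> set T, forall p, big p.2 ->
    [/\ big (f p), f p `<=` p.2 & forall G, big G -> G `<=` f p ->
      nu (f p) <= nu G + (p.1.+1%:R^-1)%:E].
  suff /choice[f fP] : forall p, exists F, big p.2 -> [/\ big F, F `<=` p.2 &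
      forall G, big G -> G `<=` F -> nu F <= nu G + (p.1.+1%:R^-1)%:E].
    by exists f.
  move=> -[n E] /=.
  have [bigE|] := pselect (big E); last by exists E.
  have [mE EA aE] := bigE.
  pose S := [set nu F | F in [set F | big F /\ F `<=` E]].
  have Sfin : ereal_inf S \is a fin_num.
    rewrite ge0_fin_numE; last by apply: le_ereal_inf_tmp => _ [F _ <-].
    apply: le_lt_trans Afin; apply: (@le_trans _ _ (nu E)).
      by apply: ereal_inf_lbound; exists E => //; split.
    by rewrite le_measure ?inE.
  have e0 : (0 < n.+1%:R^-1 :> R)%R by rewrite invr_gt0.
  have [_ [F [bigF FE] <-] hF] := lb_ereal_inf_adherent e0 Sfin.
  exists F => _; split => // G bigG GF; apply: (le_trans (ltW hF)).
  rewrite leeD2r//; apply: ereal_inf_lbound; exists G => //; split => //.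
  exact: subset_trans FE.
pose fix E n := if n is n'.+1 then f (n', E n') else A.
have bigE n : big (E n) by elim: n => //= n /(fP (n, _))[].
have niE : nonincreasing_seq E.
  by apply/nonincreasing_seqP => n; apply/subsetPset; have [] := fP (n, E n) (bigE n).
pose D := \bigcap_n E n.
have mD : measurable D by apply: bigcap_measurable => // n _; have [] := bigE n.
have DA : D `<=` A by move=> t /(_ 0%N Logic.I).
have cvgD : nu \o E @ \oo --> nu D.
  by apply: nonincreasing_cvg_mu => // n; have [] := bigE n.
have bigD : big D.
  split => //; rewrite -(cvg_lim _ cvgD)//; apply: lime_ge.
    by apply/cvg_ex; exists (nu D).
  by apply: nearW => n /=; have [] := bigE n.
(* [D] lies inside each [E n.+1], whose mass is within [1/(n+1)] of that of its big subset [G]; so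
   [G] misses less than any given mass of [D]. *)
have minD G : big G -> G `<=` D -> nu (D `\` G) = 0.
  move=> bigG GD; have [mG _ aG] := bigG.
  have Gfin : nu G \is a fin_num.
    by rewrite ge0_fin_numE// (le_lt_trans _ Afin)// le_measure ?inE//; exact: subset_trans DA.
  apply/eqP; rewrite eq_le measure_ge0 andbT.
  apply/lee_addgt0Pr => e e0; rewrite add0e.
  have [n _ ne] := near_infty_natSinv_lt (PosNum e0).
  apply: (@le_trans _ _ (n.+1%:R^-1)%:E); last by rewrite lee_fin ltW//; apply: ne => /=.
  rewrite -(leeD2lE _ _ Gfin) -measure_setD_split//.
  have [_ _ h] := fP (n, E n) (bigE n).
  apply: (le_trans _ (h _ bigG _)); last by move=> t /GD /(_ n.+1 Logic.I).
  have [mE _ _] := bigE n.+1.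
  by rewrite le_measure ?inE// => t /(_ n.+1 Logic.I).
exists D; split => //; last exact: big_gt.
have [_ _ aD] := bigD.
split => //; first by rewrite (lt_le_trans _ aD)// lte_fin.
move=> B mB BD.
have mDB : measurable (D `\` B) by exact: measurableD.
(* If [B] and its complement in [D] both had mass below [a], then [D] would have mass below [2a],
   which no big set has. *)
have [aB|Ba] := leP a%:E (nu B).
  by right; apply: minD => //; split => //; exact: subset_trans DA.
have [aDB|DBa] := leP a%:E (nu (D `\` B)).
  left; rewrite -(minD (D `\` B)); first by rewrite setDD (setIidr BD).
    by split => // t [/DA].
  by move=> t [].
have := big_gt _ bigD; rewrite (measure_setD_split nu _ mB)// ltNge => /negP[].
by rewrite ltW// lteD.
Qed.


(** Otherwise the measure with density [g] has an atom of mass above [2a] inside [A]. Its part where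
    [g] is positive is an atom of [mu], hence a single point up to a null set, and the hypothesis on
    atoms bounds the mass there by [2a]. *)
Lemma intermediate_integral (mu : {sigma_finite_measure set T -> \bar R})
    (g : T -> \bar R) (A : set T) (a : R) :
  atoms_are_singletons mu ->
  measurable_fun setT g -> (forall t, 0 <= g t < +oo) ->
  measurable A -> (0 < a)%R -> a%:E < \int[mu]_(t in A) g t ->
  (forall t, atomic_part mu t -> A t -> g t * mu [set t] <= a%:E + a%:E) ->
  exists E, [/\ measurable E, E `<=` A &
    a%:E <= \int[mu]_(t in E) g t <= a%:E + a%:E].
Proof.
move=> mu_atoms mg gfin mA a0 aA g_atoms.
have g0 t : 0 <= g t by have /andP[] := gfin t.
pose nu0 (E : set T) := \int[mu]_(t in E) g t.
have nu00 : nu0 set0 = 0 by rewrite /nu0 integral_set0.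
have nu0_ge0 E : 0 <= nu0 E by exact: integral_ge0.
have nu0_sigma : semi_sigma_additive nu0 by exact: semi_sigma_additive_nng_induced.
pose nu : {measure set T -> \bar R} :=
  HB.pack nu0 (isMeasure.Build _ _ _ nu0 nu00 nu0_ge0 nu0_sigma).
have nuE E : nu E = \int[mu]_(t in E) g t by [].
have [F [FT ndF mF]] := (sigma_finiteP _ _).1 (sigma_finiteT mu).
(* Bounding both [mu] and [g] makes [nu (D n)] finite; since the [D n] exhaust [A], one of them
   keeps mass above [a]. *)
pose D n := A `&` (F n `&` [set t | g t <= n%:R%:E]).
have mD n : measurable (D n).
  apply: measurableI => //; apply: measurableI; first by have [] := mF n.
  by rewrite -[X in measurable X]setTI; exact: emeasurable_fun_infty_c.
have ndD : nondecreasing_seq D.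
  move=> m n mn; apply/subsetPset => t [At [Fm gm]]; split => //; split.
    by move: Fm; apply/subsetPset/ndF.
  by apply: le_trans gm _; rewrite lee_fin ler_nat.
have UD : \bigcup_n D n = A.
  apply/seteqP; split => [t [n _ []]//|t At].
  have : [set: T] t by [].
  rewrite FT => -[m _ Fm].
  have [k gk] : exists k : nat, g t <= k%:R%:E.
    exists (Num.truncn (fine (g t))).+1.
    rewrite -[leLHS]fineK ?ge0_fin_numE//; last by have /andP[] := gfin t.
    by rewrite lee_fin ltW// truncnS_gt.
  exists (maxn m k) => //; split => //; split.
    by move: Fm; apply/subsetPset/ndF; rewrite leq_maxl.
  by apply: le_trans gk _; rewrite lee_fin ler_nat leq_maxr.
have : nu \o D @ \oo --> nu A.
  by rewrite -UD; apply: nondecreasing_cvg_mu => //; rewrite UD.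
move=> /cvg_lim cvgA.
have [n aDn] : exists n, a%:E < nu (D n).
  apply: contrapT => /forallNP h; move: aA; rewrite -nuE ltNge => /negP; apply.
  rewrite -cvgA//; apply: lime_le.
    apply: ereal_nondecreasing_is_cvgn => m n mn.
    by rewrite le_measure ?inE//; exact/subsetPset/ndD.
  by apply: nearW => n; rewrite leNgt; exact/negP/h.
have Dfin : nu (D n) < +oo.
  rewrite nuE (@le_lt_trans _ _ (\int[mu]_(t in D n) cst n%:R%:E t))//.
    by apply: ge0_le_integral => // [|t [_ []]//]; exact: measurable_funTS.
  rewrite integral_cst// lte_mul_pinfty ?lee_fin//.
  apply: (@le_lt_trans _ _ (mu (F n))); last by have [] := mF n.
  rewrite le_measure ?inE//; first by have [] := mF n.
  by move=> t [_ []].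
have [|[B [[mB B0 Batom] BD aB]]] := intermediate_or_atom (mD n) a0 (ltW aDn) Dfin.
  move=> [E [mE ED aE]]; exists E; split => //.
  by apply: subset_trans ED _ => t [].
(* Inside [C] the null sets of [nu] and of [mu] coincide, so [C] is an atom of [mu] because [B] is
   one of [nu]. *)
pose C := B `&` [set t | 0 < g t].
have mC : measurable C.
  apply: measurableI => //.
  by rewrite -[X in measurable X]setTI; exact: emeasurable_fun_o_infty.
have nuC E : measurable E -> nu E = 0 -> mu (E `&` [set t | 0 < g t]) = 0.
  move=> mE; rewrite nuE.
  under eq_integral do rewrite -[g _]gee0_abs//.
  move=> /ae_eq_integral_abs => /(_ mE (measurable_funTS mg)) [N [mN N0 sN]].
  apply: (subset_measure0 _ mN _ N0) => [|t [Et g_gt0]].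
    apply: measurableI => //.
    by rewrite -[X in measurable X]setTI; exact: emeasurable_fun_o_infty.
  by apply: sN => /= /(_ Et) gt0; move: g_gt0; rewrite /= gt0 ltxx.
have mu_nu E : measurable E -> mu E = 0 -> nu E = 0.
  move=> mE E0; rewrite nuE -[RHS](integral0 mu E).
  apply: ae_eq_integral => //; first exact: measurable_funTS.
  by exists E; split => // t /= /not_implyP[].
have nuBC : nu B = nu C.
  rewrite (measure_setD_split nu mB mC); last by move=> t [].
  rewrite [X in _ + X](_ : _ = 0) ?adde0// nuE; apply: integral0_eq => t [Bt Ct].
  by apply/eqP; rewrite eq_le g0 andbT leNgt; apply/negP => gt; apply: Ct.
have muC : 0 < mu C.
  rewrite lt0e measure_ge0 andbT; apply/eqP => /(mu_nu _ mC) C0.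
  by move: B0; rewrite nuBC C0 ltxx.
have [t [[Bt gt] mt Ct0]] : exists t, [/\ C t, measurable [set t] & mu (C `\ t) = 0].
  apply: mu_atoms; split => // S mS SC.
  have SB : S `<=` B by move=> t /SC[].
  have [S0|BS0] := Batom _ mS SB; [left|right].
    by rewrite -(nuC _ mS S0) setIidl// => t /SC[].
  have mBS : measurable (B `\` S) by exact: measurableD.
  rewrite -(nuC _ mBS BS0); congr (mu _).
  by apply/seteqP; split => [t [[Bt gt] St]|t [[Bt St] gt]].
have tC : [set t] `<=` C by move=> _ ->.
have atom_t : atomic_part mu t.
  split => //.
    apply: (eq_ind (mu C) (fun x => 0 < x) muC).
  by rewrite (measure_setD_split mu mC mt)// -[RHS]adde0; congr (_ + _); exact: Ct0.
  move=> S mS /subset_set1[->|->]; first by left; rewrite measure0.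
  by right; rewrite setDv measure0.
have At : A t by have [] := BD _ Bt.
have := g_atoms t atom_t At; rewrite leNgt => /negP[].
apply: (lt_le_trans aB); rewrite nuBC (measure_setD_split nu mC mt)//.
rewrite (mu_nu _ (measurableD mC mt) Ct0) adde0 nuE.
rewrite (eq_integral (cst (g t))); last by move=> u; rewrite inE => ->.
by rewrite integral_cst.
Qed.

End atoms.

(** * Countability and measurability of sets of atoms *)

Section atomic_part.
Context d (T : measurableType d) (R : realType).
Local Open Scope ereal_scope.

(** A set of finite measure contains only finitely many points of mass above [1/(m+1)]. *)
Lemma countable_atomic_part (mu : {sigma_finite_measure set T -> \bar R}) :
  countable (atomic_part mu).
Proof.
have [F FT mF] := sigma_finiteT mu.
pose A k m := [set t | [/\ atomic_part mu t, F k t & (m.+1%:R^-1)%:E < mu [set t]]].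
apply: (@sub_countable _ _ _ (\bigcup_k \bigcup_m A k m)).
  apply: subset_card_le => t at_t.
  have : [set: T] t by [].
  rewrite FT => -[k _ Fk]; exists k => //.
  have mu_gt0 : 0 < mu [set t] by have [] := at_t.
  have [e e0 emu] : exists2 e : R, (0 < e)%R & e%:E <= mu [set t].
    case: (mu [set t]) mu_gt0 => [r|_|//]; first by rewrite lte_fin => r0; exists r.
    by exists 1%R => //; rewrite leey.
  have [m _ me] := near_infty_natSinv_lt (PosNum e0).
  exists m => //; split => //; apply: lt_le_trans emu.
  by rewrite lte_fin; apply: me => /=.
apply: bigcup_countable => // k _; apply: bigcup_countable => // m _.
apply: finite_set_countable; apply: contrapT => infA.
have [mFk Fk_fin] := mF k.
pose r : R := fine (mu (F k)).
(* Chosen so that [n] points of mass above [1/(m+1)] outweigh [F k]. *)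
pose n := (Num.truncn (r * m.+1%:R)).+1.
have [B BA nB] := infinite_set_fset n infA.
have mB t : t \in B -> measurable [set t].
  by move=> /BA[[]].
have : mu (\big[setU/set0]_(t <- B) [set t]) <= mu (F k).
  rewrite -bigcup_fset; apply: le_measure; [|exact/mem_set|].
    by apply/mem_set/fin_bigcup_measurable => [|t]; [exact: finite_fset|exact: mB].
  by move=> _ [t /BA[_ Ft _] ->].
rewrite measure_fbigsetU//; last by move=> t u _ _ [v [-> ->]].
apply/negP; rewrite -ltNge.
rewrite -[ltLHS]fineK ?ge0_fin_numE//.
apply: (@lt_le_trans _ _ (\sum_(t <- B) (m.+1%:R^-1)%:E)); last first.
  rewrite big_seq [leRHS]big_seq; apply: lee_sum => t /BA[_ _ /ltW]//.
rewrite sumEFin lte_fin big_const_seq count_predT iter_addr_0.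
rewrite -(ltr_pM2r (ltr0Sn _ m)) mulrnAl mulVf ?pnatr_eq0//.
apply: (lt_le_trans (truncnS_gt _)).
by rewrite ler_nat.
Qed.

(** By countability there is an injection into [nat]; each of its fibres is empty or a measurable
    singleton. *)
Lemma measurable_sub_atomic_part (mu : {sigma_finite_measure set T -> \bar R})
    (A : set T) : A `<=` atomic_part mu -> measurable A.
Proof.
move=> Asub.
have cA : countable A := sub_countable (subset_card_le Asub) (countable_atomic_part mu).
move: cA => /countable_injP[f injf].
have -> : A = \bigcup_n (A `&` f @^-1` [set n]).
  by apply/seteqP; split => [t At|t [n _ []]//]; exists (f t).
apply: bigcup_measurable => n _.
have [[t [At ft]]|none] := pselect (exists t, (A `&` f @^-1` [set n]) t); last first.
  rewrite (_ : _ `&` _ = set0)//.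
  by apply/seteqP; split => // t tn; apply: none; exists t.
rewrite (_ : _ `&` _ = [set t]); first by have [] := Asub t At.
apply/seteqP; split => [u [Au fu]|_ ->//].
by apply: injf; [exact/mem_set|exact/mem_set|move: ft fu => /= -> ->].
Qed.

End atomic_part.

(** * The regularized modular *)

Section star_integrand.
Context d (T : measurableType d) (R : realType).
Variable mu : {measure set T -> \bar R}.
Local Open Scope ereal_scope.
Local Notation J phi := (modular mu (fun t => lreg (phi t))).
Implicit Types (phi : T -> R -> \bar R) (x y s : T -> R).

(** Star-shapedness is required at every point, whereas the Young property holds only a.e.;
    pointwise estimates then carry no exceptional set. *)
Record star_integrand phi : Prop := StarIntegrand {
  star_integrandP : forall t, star_shaped (phi t) ;
  star_integrand_measurable : forall u : R, (0 <= u)%R ->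
    measurable_fun [set: T] (phi ^~ u) }.

Lemma measurable_patch d' (U : measurableType d') (A : set T) (f g : T -> U) :
  measurable A -> measurable_fun setT f -> measurable_fun setT g ->
  measurable_fun setT (fun t => if t \in A then f t else g t).
Proof.
move=> mA mf mg; apply: measurable_fun_ifT => //.
by apply: (measurable_fun_bool true); rewrite setTI preimage_mem_true.
Qed.

Lemma measurable_lreg phi x : star_integrand phi -> measurable_fun setT x ->
  measurable_fun setT (fun t => lreg (phi t) (x t)).
Proof.
move=> [_ mphi] mx.
rewrite (_ : (fun t => _) = (fun t => esups (fun n =>
    if (nnrat n < x t)%R then phi t (nnrat n) else 0) 0%N)).
  apply: measurable_fun_esups => n.
  apply: measurable_fun_ifT => //; first exact: measurable_fun_ltr.
  exact/mphi/nnrat_ge0.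
apply/funext => t; rewrite /lreg /esups/=; congr ereal_sup.
by apply/seteqP; split => [_ [n _ <-]|_ [n _ <-]]; exists n.
Qed.

Lemma lreg_modular_ge0 phi x : star_integrand phi ->
  0 <= J phi x.
Proof.
by move=> [sphi _]; apply: integral_ge0 => t _; apply: lreg_ge0 => u; exact: star_ge0.
Qed.

Lemma lreg_norm_ge0 phi x t : star_integrand phi -> 0 <= lreg (phi t) `|x t|%R.
Proof. by move=> [sphi _]; apply: lreg_ge0 => u; exact: star_ge0. Qed.

Lemma measurable_lreg_norm phi x : star_integrand phi ->
  measurable_fun setT x ->
  measurable_fun setT (fun t => lreg (phi t) `|x t|%R).
Proof.
by move=> sphi mx; apply: measurable_lreg => //; exact: measurableT_comp.
Qed.

Lemma le_lreg_modular phi x y : star_integrand phi ->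
  measurable_fun setT x -> measurable_fun setT y ->
  {ae mu, forall t, (`|x t| <= `|y t|)%R} ->
  J phi x <= J phi y.
Proof.
move=> sphi mx my xy; apply: ae_ge0_le_integral => //.
- by move=> t _; exact: lreg_norm_ge0.
- exact: measurable_lreg_norm.
- by move=> t _; exact: lreg_norm_ge0.
- exact: measurable_lreg_norm.
- move: xy; apply: filterS => t xy _; apply: lreg_homo => // u.
  by have [h _] := sphi; exact: star_ge0.
Qed.

Lemma lreg_modular_scale phi x l : star_integrand phi -> (0 <= l <= 1)%R ->
  measurable_fun setT x ->
  J phi (fun t => l * x t)%R <=
  l%:E * J phi x.
Proof.
move=> sphi l01 mx; have [l0 l1] := andP l01.
rewrite -ge0_integralZl//.
- apply: ge0_le_integral => //.
  + by move=> t _; exact: (lreg_norm_ge0 (fun t => l * x t)%R).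
  + by apply: (@measurable_lreg_norm phi (fun t => l * x t)%R) => //; exact: measurable_funM.
  + by apply: measurable_funeM; exact: measurable_lreg_norm.
  + move=> t _; rewrite normrM (ger0_norm l0).
    by have [h _] := sphi; exact: lreg_star.
- exact: measurable_lreg_norm.
- by move=> t _; exact: lreg_norm_ge0.
Qed.

End star_integrand.

(** * From a bounded multiplier to an integrable bound on the conjugate *)

Section multiplier_to_conjugate.
Context d (T : measurableType d) (R : realType).
Variable mu : {sigma_finite_measure set T -> \bar R}.
Local Open Scope ereal_scope.
Local Notation J phi := (modular mu (fun t => lreg (phi t))).
Variables (phi phi1 : T -> R -> \bar R) (y : T -> R).
Hypothesis mu_atoms : atoms_are_singletons mu.
Hypothesis sphi : star_integrand phi.
Hypothesis sphi1 : star_integrand phi1.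
Hypothesis my : measurable_fun setT y.
Hypothesis y_mult : forall x, measurable_fun setT x ->
  J phi1 x <= 1 -> J phi (fun t => x t * y t)%R <= 1.

(** The factor [4^-1] serves the contradiction: a set [E] where [h < F], of [h]-mass in [[1/2, 1]],
    would satisfy 1/2 <= integral of [F] <= 1/4 of the integral of [G] <= 1/4. So the [h]-mass of
    [A] is at most 1/2, and the multiplier bound applies to [A] itself. *)
Lemma multiplier_selection (s : T -> R) :
  measurable_fun setT s -> (forall t, 0 <= s t)%R ->
  measurable_fun setT (fun t => phi1 t (s t)) ->
  (forall t, phi1 t (s t) < +oo) ->
  (forall t, atomic_part mu t -> phi1 t (s t) * mu [set t] <= 1) ->
  \int[mu]_t maxe 0 (lreg (phi t) (4^-1 * (s t * `|y t|))%R - phi1 t (s t)) <= 1.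
Proof.
move=> ms s0 mh hfin h_atoms.
have [sphi_ _] := sphi; have [sphi1_ _] := sphi1.
set F := fun t => lreg (phi t) (4^-1 * (s t * `|y t|))%R.
set h := fun t => phi1 t (s t).
set G := fun t => lreg (phi t) (s t * `|y t|)%R.
have msy : measurable_fun setT (fun t => s t * `|y t|)%R.
  by apply: measurable_funM => //; exact: measurableT_comp.
have sy0 t : (0 <= s t * `|y t|)%R by rewrite mulr_ge0.
have mF : measurable_fun setT F by apply: measurable_lreg => //; exact: measurable_funM.
have mG : measurable_fun setT G by exact: measurable_lreg.
have F0 t : 0 <= F t by apply: lreg_ge0 => u; exact: star_ge0.
have G0 t : 0 <= G t by apply: lreg_ge0 => u; exact: star_ge0.
have h0 t : 0 <= h t by exact: star_ge0.
have FG t : F t <= (4^-1)%:E * G t.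
  by apply: lreg_star => //; rewrite invr_ge0 invf_le1 ?ler1n ?ler0n ?ltr0n.
have FG1 t : F t <= G t.
  by apply: lreg_homo => [u|]; [exact: star_ge0|rewrite ler_piMl// invf_le1 ?ler1n].
pose A := [set t | h t < F t].
have mA : measurable A by rewrite -[X in measurable X]setTI; exact: measurable_lte.
have mult E : measurable E -> \int[mu]_(t in E) h t <= 1 -> \int[mu]_(t in E) G t <= 1.
  move=> mE hE.
  pose x t : R := if t \in E then s t else 0%R.
  have mx : measurable_fun setT x by exact: measurable_patch.
  have -> : \int[mu]_(t in E) G t = J phi (fun t => x t * y t)%R.
    rewrite integral_mkcond; apply: eq_integral => t _.
    rewrite patchE /x; case: ifPn => _; first by rewrite normrM (ger0_norm (s0 t)).
    by rewrite mul0r normr0 lreg0// => u; exact: star_ge0.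
  apply: y_mult => //; apply: le_trans hE.
  rewrite [leRHS]integral_mkcond; apply: ge0_le_integral => //.
  - by move=> t _; exact: lreg_norm_ge0.
  - exact: measurable_lreg_norm.
  - by apply/(measurable_restrictT _ _).1 => //; exact: measurable_funTS.
  - move=> t _; rewrite patchE /x; case: ifPn => _.
      by rewrite (ger0_norm (s0 t)) lreg_le.
    by rewrite normr0 lreg0// => u; exact: star_ge0.
have intF : \int[mu]_t maxe 0 (F t - h t) <= \int[mu]_(t in A) F t.
  rewrite [leRHS]integral_mkcond; apply: ge0_le_integral => //.
  - by move=> t _; rewrite le_max lexx.
  - by apply: measurable_maxe => //; exact: emeasurable_funB.
  - by apply/(measurable_restrictT _ _).1 => //; exact: measurable_funTS.
  - move=> t _; rewrite patchE ge_max; case: ifPn => [|tA].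
      by rewrite F0 -[leRHS]sube0 leeB.
    rewrite lexx/= leNgt sube_gt0; apply/negP => tA'; move/negP: tA; apply.
    exact/mem_set.
apply: (le_trans intF).
have [hA|hA] := leP (\int[mu]_(t in A) h t) (2^-1)%:E.
  apply: le_trans (mult A mA _); last first.
    by apply: le_trans hA _; rewrite lee_fin invf_le1 ?ler1n.
  by apply: ge0_le_integral => //; exact: measurable_funTS.
(* With [a = 1/2], the bound [a + a] is both the mass allowed at an atom and the radius of the unit
   ball. *)
have half : (2^-1 : R)%:E + (2^-1)%:E = 1 by rewrite -EFinD; congr EFin; lra.
have [|||E] := @intermediate_integral _ _ _ mu h A (2^-1)%R mu_atoms mh _ mA _ hA.
- by move=> t; rewrite h0 hfin.
- by rewrite invr_gt0.
- by move=> t at_t _; rewrite half; exact: h_atoms.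
rewrite half => -[mE EA /andP[hE1 hE2]].
have := mult E mE hE2 => GE.
have : (2^-1)%:E <= (4^-1)%:E * 1 :> \bar R.
  apply: (le_trans hE1); apply: (@le_trans _ _ (\int[mu]_(t in E) ((4^-1)%:E * G t))).
    apply: ge0_le_integral => //; [exact: measurable_funTS| |].
      by apply/measurable_funTS/measurable_funeM.
    by move=> t /EA At; apply: le_trans (FG t); exact: ltW.
  rewrite ge0_integralZl//; last exact: measurable_funTS.
  by rewrite lee_wpmul2l// lee_fin.
by rewrite mule1 lee_fin => h24; exfalso; move: h24; lra.
Qed.

(** [Psi] is the supremum over [k] of the positive parts of the admissible differences. Each finite
    maximum is dominated by the expression in [multiplier_selection] for one measurable [s], and
    monotone convergence passes to the limit. *)
Lemma multiplier_dominated : exists Psi : T -> \bar R,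
  [/\ measurable_fun setT Psi, forall t, 0 <= Psi t, \int[mu]_t Psi t <= 1 &
    forall k t,
      (atomic_part mu t -> phi1 t (nnrat k) * mu [set t] <= 1) ->
      lreg (phi t) (4^-1 * (nnrat k * `|y t|))%R - phi1 t (nnrat k) <= Psi t].
Proof.
have [sphi_ _] := sphi; have [sphi1_ mphi1] := sphi1.
(* The atoms at which the value [nnrat k] violates the truncation; there [g k] is set to 0. *)
pose Q k := [set t | atomic_part mu t /\ 1 < phi1 t (nnrat k) * mu [set t]].
have mQ k : measurable (Q k) by apply: (@measurable_sub_atomic_part _ _ _ mu) => t [].
pose D (s : T -> R) t := lreg (phi t) (4^-1 * (s t * `|y t|))%R - phi1 t (s t).
pose g k t := if t \in Q k then 0 else maxe 0 (D (cst (nnrat k)) t).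
have mD s : measurable_fun setT s -> measurable_fun setT (fun t => phi1 t (s t)) ->
    measurable_fun setT (D s).
  move=> ms mh; apply: emeasurable_funB => //; apply: measurable_lreg => //.
  by apply: measurable_funM => //; apply: measurable_funM => //; exact: measurableT_comp.
have mg k : measurable_fun setT (g k).
  apply: measurable_patch => //; apply: measurable_maxe => //.
  by apply: mD => //; apply: mphi1; exact: nnrat_ge0.
pose G := fix G (n : nat) (t : T) {struct n} : \bar R :=
  if n is k.+1 then maxe (G k t) (g k t) else 0.
have GS n t : G n.+1 t = maxe (G n t) (g n t) by [].
have G_0 t : G 0%N t = 0 by [].
have mG n : measurable_fun setT (G n).
  elim: n => [|n IH].
    by rewrite (_ : G 0%N = cst 0)//; apply/funext.
  rewrite (_ : G n.+1 = fun t => maxe (G n t) (g n t)); last by apply/funext => t; exact: GS.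
  exact: measurable_maxe.
have G0 n t : 0 <= G n t.
  by elim: n => [|n IH]; rewrite ?G_0// GS le_max IH.
have ndG t : nondecreasing_seq (G ^~ t).
  by apply/nondecreasing_seqP => n; rewrite GS le_max lexx.
have sel n : exists s : T -> R, [/\ measurable_fun setT s /\ (forall t, 0 <= s t)%R,
    measurable_fun setT (fun t => phi1 t (s t)), forall t, phi1 t (s t) < +oo,
    forall t, atomic_part mu t -> phi1 t (s t) * mu [set t] <= 1 &
    forall t, G n t <= maxe 0 (D s t)].
  elim: n => [|n [s [[ms s0] mh hfin h_at GD]]].
    exists (cst 0%R); split => //=.
    - exact: mphi1.
    - by move=> t; rewrite star0.
    - by move=> t _; rewrite star0// mul0e.
    - by move=> t; rewrite le_max lexx.
  (* The selection switches to [nnrat n] where this improves the running maximum. There [g n] is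
     positive, which excludes both [Q n] and an infinite value of [phi1]. *)
  pose W := [set t | G n t < g n t].
  have mW : measurable W by rewrite -[X in measurable X]setTI; exact: measurable_lte.
  have WQ t : W t -> ~ Q n t.
    move=> Wt Qt; have : G n t < g n t by [].
    by rewrite /g mem_set// ltNge G0.
  have Wg t : W t -> g n t = maxe 0 (D (cst (nnrat n)) t).
    by move=> Wt; rewrite /g memNset//; exact: WQ.
  exists (fun t => if t \in W then nnrat n else s t); split.
  - split; first exact: measurable_patch.
    by move=> t; case: ifPn => _ //; exact: nnrat_ge0.
  - rewrite (_ : (fun t => _) =
        fun t => if t \in W then phi1 t (nnrat n) else phi1 t (s t)).
      by apply: measurable_patch => //; apply: mphi1; exact: nnrat_ge0.
    by apply/funext => t; case: ifPn.
  - move=> t; case: ifPn => // /set_mem Wt.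
    have : G n t < g n t by [].
    rewrite (Wg _ Wt) /D /cst; move: (phi1 t (nnrat n)) => [r _|/=|]; rewrite ?ltry ?ltNyr//.
    by rewrite addeNy maxeNy ltNge G0.
  - move=> t at_t; case: ifPn => [/set_mem /WQ nQ|_]; last exact: h_at.
    by rewrite leNgt; apply/negP => ?; apply: nQ.
  - move=> t; rewrite GS /D; case: ifPn => [Wt|].
      rewrite -(Wg t (set_mem Wt)) ge_max lexx andbT; exact/ltW/set_mem/Wt.
    move=> Wt; rewrite ge_max GD/=; apply: le_trans (GD t).
    by rewrite leNgt; apply/negP => ?; move/negP: Wt; apply; exact/mem_set.
exists (fun t => limn (G ^~ t)).
have cvgG t : cvgn (G ^~ t) by exact: ereal_nondecreasing_is_cvgn.
split.
- by apply: (emeasurable_fun_cvg G) => // t _; exact: cvgG.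
- by move=> t; apply: lime_ge => //; exact: nearW.
- rewrite monotone_convergence//.
  apply: lime_le.
    apply: ereal_nondecreasing_is_cvgn => m n mn; apply: ge0_le_integral => // t _.
    exact: ndG.
  apply: nearW => n; have [s [[ms s0] mh hfin h_at GD]] := sel n.
  apply: le_trans (multiplier_selection ms s0 mh hfin h_at).
  apply: ge0_le_integral => // [|t _]; last exact: GD.
  by apply: measurable_maxe => //; exact: (mD s).
- move=> k t nQ; apply: (@le_trans _ _ (G k.+1 t)).
    rewrite GS /g memNset; first by rewrite !le_max lexx !orbT.
    by move=> [/nQ nQt]; rewrite ltNge nQt.
  rewrite (cvg_lim _ (ereal_nondecreasing_cvgn (ndG t)))//.
  by apply: ereal_sup_ubound; exists k.+1.
Qed.

End multiplier_to_conjugate.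

(** * Uniform boundedness of a multiplier *)

Section gliding_hump.
Context d (T : measurableType d) (R : realType).
Variable mu : {measure set T -> \bar R}.
Local Open Scope ereal_scope.
Local Notation J phi := (modular mu (fun t => lreg (phi t))).

(* Were there no K, x = sup_n 2^-(n+1) |X n| would contradict the hypothesis for
   X n in the unit ball with J phi (X n y / 4^n) > 1. *)
Lemma gliding_hump (phi phi1 : T -> R -> \bar R) (y : T -> R) :
  star_integrand phi -> star_integrand phi1 -> measurable_fun setT y ->
  (forall x, measurable_fun setT x -> J phi1 x < +oo ->
    exists2 l, (0 < l)%R & J phi (fun t => l * (x t * y t))%R < +oo) ->
  exists2 K, (0 < K)%R & forall x, measurable_fun setT x -> J phi1 x <= 1 ->
    J phi (fun t => x t * (y t / K))%R <= 1.
Proof.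
move=> sphi sphi1 my y_mult.
have [sphi1_ _] := sphi1; have [sphi_ _] := sphi.
apply: contrapT => noK.
have /choice[X XP] : forall n : nat, exists x : T -> R,
    [/\ measurable_fun setT x, J phi1 x <= 1 &
        1 < J phi (fun t => x t * (y t / 4 ^+ n))%R].
  move=> n; apply: contrapT => h; apply: noK; exists (4 ^+ n)%R; first by rewrite exprn_gt0.
  move=> x mx Jx; rewrite leNgt; apply/negP => Jxy.
  by apply: h; exists x.
have mX n : measurable_fun setT (X n) by have [] := XP n.
pose e n : R := ((2 ^ n.+1)%:R^-1)%R.
have e01 n : (0 <= e n <= 1)%R.
  by rewrite invr_ge0 ler0n/= invf_le1 ?ler1n ?expn_gt0// ltr0n expn_gt0.
have e_ge0 n : (0 <= e n)%R by have /andP[] := e01 n.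
have e_gt0 n : (0 < e n)%R by rewrite invr_gt0 ltr0n expn_gt0.
(* The weights sum to 1, so [S] has integral at most 1. It also dominates [lreg (phi1 t) (x t)],
   because a value below a supremum is below one of its terms. *)
pose S t := \sum_(n <oo) (e n)%:E * lreg (phi1 t) `|X n t|%R.
have term0 n t : 0 <= (e n)%:E * lreg (phi1 t) `|X n t|%R.
  by rewrite mule_ge0 ?lee_fin//; exact: lreg_norm_ge0.
have mterm n : measurable_fun setT (fun t => (e n)%:E * lreg (phi1 t) `|X n t|%R).
  by apply: measurable_funeM; exact: measurable_lreg_norm.
have S0 t : 0 <= S t by exact: nneseries_ge0.
have mS : measurable_fun setT S.
  apply: (@ge0_emeasurable_sum _ _ _ setT
    (fun n t => (e n)%:E * lreg (phi1 t) `|X n t|%R) xpredT) => //.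
have intS : \int[mu]_t S t <= 1.
  rewrite integral_nneseries//.
  apply: le_trans (epsilon_trick0 xpredT ler01).
  apply: lee_nneseries => [n _ _|n _]; first exact: integral_ge0.
  rewrite ge0_integralZl ?lee_fin//; last 2 first.
  - exact: measurable_lreg_norm.
  - by move=> t _; exact: lreg_norm_ge0.
  rewrite div1r -[leRHS]mule1 lee_wpmul2l ?lee_fin//.
  by have [] := XP n.
have leS v t n : (0 <= v)%R -> (v < e n * `|X n t|)%R -> phi1 t v <= S t.
  move=> v0 vX; apply: le_trans (le_lreg (sphi1_ t) v0 vX) _.
  apply: le_trans (lreg_star (sphi1_ t) (e01 n) (normr_ge0 _)) _.
  rewrite /S (@nneseriesD1 _ _ n)//.
  by rewrite leeDl//; apply: nneseries_ge0 => k _ _; exact: term0.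
pose u t := ereal_sup (range (fun n => (e n * `|X n t|)%:E)).
(* [fine] sends an infinite supremum to 0, which preserves the bound by [S]; [Xx] relies on this
   happening only on a null set. *)
pose x t := fine (u t).
have u_ge n t : (e n * `|X n t|)%:E <= u t by apply: ereal_sup_ubound; exists n.
have u0 t : 0 <= u t.
  by apply: le_trans (u_ge 0%N t); rewrite lee_fin mulr_ge0// ltW.
have x0 t : (0 <= x t)%R by exact: fine_ge0.
have mx : measurable_fun setT x.
  apply: measurableT_comp => //.
  rewrite (_ : u = fun t => esups (fun n => (e n * `|X n t|)%:E) 0%N).
    apply: measurable_fun_esups => n; apply/measurable_EFinP.
    by apply: measurable_funM => //; exact: measurableT_comp.
  apply/funext => t; rewrite /u /esups/=; congr ereal_sup.
  by apply/seteqP; split => [_ [n _ <-]|_ [n _ <-]]; exists n.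
have xS t : lreg (phi1 t) `|x t|%R <= S t.
  apply: lreg_leP => // v /andP[v0]; rewrite (ger0_norm (x0 t)).
  rewrite -lte_fin /x; have [ufin|] := boolP (u t \is a fin_num).
    rewrite fineK// => /ereal_sup_gt[_ [n _ <-]]; rewrite lte_fin; exact: leS.
  rewrite ge0_fin_numE// -leNgt leye_eq => /eqP -> /=.
  by rewrite lte_fin ltNge v0.
have Jx : J phi1 x <= 1.
  apply: le_trans intS; apply: ge0_le_integral => //.
    by move=> t _; exact: lreg_norm_ge0.
  exact: measurable_lreg_norm.
have [l l0 Jl] := y_mult x mx (le_lt_trans Jx (ltry _)).
have Xx : {ae mu, forall t, forall n, (e n * `|X n t| <= x t)%R}.
  have /integrable_ae : mu.-integrable setT S.
    apply/integrableP; split => //.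
    under eq_integral do rewrite gee0_abs//.
    exact: le_lt_trans intS (ltry _).
  move=> /(_ measurableT); apply: filterS => t /(_ Logic.I) Sfin n.
  rewrite -lee_fin /x fineK//; rewrite ge0_fin_numE// ltNge leye_eq; apply/negP => /eqP uy.
  (* If [u t] were infinite, [S t] would bound all values of [phi1 t]. *)
  have [w w0] := star_unbounded (sphi1_ t) (fine (S t)).
  rewrite fineK// ltNge => /negP; apply.
  have : w%:E < u t by rewrite uy ltry.
  by move=> /ereal_sup_gt[_ [k _ <-]]; rewrite lte_fin; exact: leS.
pose c := fine (J phi (fun t => l * (x t * y t))%R).
have c0 : (0 <= c)%R by apply: fine_ge0; exact: lreg_modular_ge0.
have cE : J phi (fun t => l * (x t * y t))%R = c%:E.
  by rewrite fineK// ge0_fin_numE//; exact: lreg_modular_ge0.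
(* From [|X n| <= 2^(n+1) x] it follows that [|X n y| / 4^n <= r l x |y|] with [r = 2 / (2^n l)].
   This [n] makes [r (1 + c) <= 1], so the modular is at most [r c <= 1]. *)
have [n n_gt] : exists n : nat, (2 / l * (1 + c) < 2 ^+ n)%R.
  exists (Num.truncn (2 / l * (1 + c))).+1; apply: lt_trans (truncnS_gt _) _.
  by move: (_.+1) => n; rewrite -natrX ltr_nat ltn_expl.
have [_ _] := XP n; apply/negP; rewrite -leNgt.
pose r : R := (2 / (2 ^+ n * l))%R.
have rE : r = (2 / (2 ^+ n * l))%R by [].
clearbody r.
have r0 : (0 <= r)%R by rewrite rE divr_ge0// mulr_ge0 ?exprn_ge0 ?ltW.
have rc : (r * (1 + c) <= 1)%R.
  rewrite rE mulrAC ler_pdivrMr ?mulr_gt0 ?exprn_gt0// mul1r.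
  by move: n_gt; rewrite mulrAC ltr_pdivrMr// => /ltW.
have r1 : (r <= 1)%R.
  apply: le_trans rc; rewrite ler_peMr//; lra.
have mxy : measurable_fun setT (fun t => l * (x t * y t))%R.
  by apply: measurable_funM => //; exact: measurable_funM.
apply: (@le_trans _ _ (J phi (fun t => r * (l * (x t * y t)))%R)).
  apply: le_lreg_modular => //.
  - by apply: measurable_funM => //; exact: measurable_funM.
  - exact: measurable_funM.
  - move: Xx; apply: filterS => t /(_ n) Xx.
    have XE : (`|X n t| <= 2 ^+ n.+1 * x t)%R.
      by move: Xx; rewrite /e natrX mulrC ler_pdivrMr ?exprn_gt0// mulrC.
    rewrite !normrM (ger0_norm r0) (gtr0_norm l0) (ger0_norm (x0 t)).
    rewrite normfV (ger0_norm (exprn_ge0 n _))//.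
    rewrite [leRHS](_ : _ = 2 ^+ n.+1 * x t * (`|y t| / 4 ^+ n))%R.
      by apply: ler_wpM2r XE; rewrite divr_ge0// exprn_ge0.
    rewrite rE (_ : 4 = 2 * 2 :> R)%R; last by lra.
    rewrite exprMn exprS.
    have : (2 ^+ n != 0 :> R)%R by rewrite expf_neq0.
    have : (l != 0)%R by rewrite gt_eqF.
    move: (2 ^+ n)%R => p l_neq0 p_neq0; field.
    by rewrite l_neq0 p_neq0.
apply: (@le_trans _ _ (r%:E * J phi (fun t => l * (x t * y t))%R)).
  by apply: lreg_modular_scale => //; rewrite r0 r1.
rewrite cE lee_fin; apply: le_trans rc.
by rewrite ler_wpM2l// lerDr.
Qed.

End gliding_hump.

(** * Pointwise estimates for the conjugate *)

Section conjugate.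
Context d (T : measurableType d) (R : realType).
Variable mu : {measure set T -> \bar R}.
Local Open Scope ereal_scope.
Implicit Types (phi : T -> R -> \bar R) (t : T).

(** Converts the truncation level [1 / mu {t}] into a bound on the mass at [t]; for infinite [m]
    both sides force [a = 0]. *)
Lemma le_inve (a m : \bar R) : 0 <= a -> 0 < m -> (a <= m^-1) = (a * m <= 1).
Proof.
case: m => [m||//].
  move=> a0; rewrite lte_fin => m0; rewrite inver gt_eqF//.
  by rewrite -lee_pdivlMr// mul1e.
move=> + _; rewrite invey; case: a => [a||//]; last by move=> _; rewrite mulyy.
rewrite lee_fin le_eqVlt => /predU1P[<-|a0]; first by rewrite mul0e lexx lee01.
by rewrite gt0_muley ?lte_fin// !lee_fin leNgt a0 leye_eq.
Qed.

(** The supremum is tested at [s = u / 2]. The point [u] may reach [mo_bound], while [u / 2] meets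
    the range condition both on and off the atoms, and [phi1 t (u / 2)] is at most
    [lreg (phi1 t) u]. *)
Lemma le_mo_conj phi phi1 t (u v : R) :
  star_shaped (phi t) -> star_shaped (phi1 t) -> mo_supp phi1 t ->
  (0 <= u)%R -> (0 <= v)%R -> lreg (phi1 t) u < +oo ->
  (atomic_part mu t -> lreg (phi1 t) u * mu [set t] <= 1) ->
  lreg (phi t) (2^-1 * (u * v))%R - lreg (phi1 t) u <= mo_conj mu phi phi1 t v.
Proof.
move=> sphi sphi1 supp u0 v0 ufin uatom.
have s0 : (0 <= u / 2)%R by rewrite divr_ge0.
have le_s : phi1 t (u / 2)%R <= lreg (phi1 t) u.
  move: u0 {ufin uatom s0}; rewrite le_eqVlt => /predU1P[<-|u0].
    by rewrite mul0r star0// lreg_ge0//; exact: star_ge0.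
  by apply: le_lreg => //; lra.
have le_of (M : \bar R) w : (0 <= w)%R ->
    lreg (phi1 t) u <= M -> M < phi1 t w -> (u <= w)%R.
  move=> w0 uM Mw; rewrite leNgt; apply/negP => wu.
  by move: Mw; rewrite ltNge (le_trans (le_lreg sphi1 w0 wu)).
have u_bound : u%:E <= mo_bound phi1 t.
  apply: le_ereal_inf_tmp => _ [w [w0 wy] <-]; rewrite lee_fin.
  by apply: (le_of (lreg (phi1 t) u)) => //; rewrite wy.
apply: (@le_trans _ _ (phi t (u / 2 * v)%R - phi1 t (u / 2)%R)).
  apply: leeB => //.
  have -> : (2^-1 * (u * v) = u / 2 * v)%R by lra.
  by apply: lreg_le => //; rewrite mulr_ge0.
rewrite /mo_conj; case: ifPn => [/set_mem at_t|_];
  apply: ereal_sup_ubound; exists (u / 2)%R => //; split=> //.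
  rewrite le_min; apply/andP; split.
    apply: (@le_trans _ _ u%:E); first by rewrite lee_fin; lra.
    apply: le_ereal_inf_tmp => _ [w [w0 wy] <-]; rewrite lee_fin.
    apply: le_of wy => //; rewrite le_inve//; first exact: uatom.
      by apply: lreg_ge0; exact: star_ge0.
    by have [] := at_t.
  by rewrite EFinM inver ifF ?lee_wpmul2r// ?lee_fin ?invr_ge0//; apply/negbTE; rewrite pnatr_eq0.
move: u0; rewrite le_eqVlt => /predU1P[<-|u0]; first by rewrite mul0r.
by apply: lt_le_trans u_bound; rewrite lte_fin; lra.
Qed.

Lemma mo_conj_ge0 phi phi1 t (v : R) :
  star_shaped (phi t) -> star_shaped (phi1 t) -> mo_supp phi1 t ->
  (0 <= v)%R -> 0 <= mo_conj mu phi phi1 t v.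
Proof.
move=> sphi sphi1 supp v0.
have := @le_mo_conj phi phi1 t 0%R v sphi sphi1 supp (lexx _) v0.
rewrite mul0r mulr0 !lreg0; [|exact: star_ge0|exact: star_ge0].
by rewrite subee// mul0e; apply => // _; exact: lee01.
Qed.

(** Each [s > 0] is replaced by a rational in []s / 2, s[]. Losing up to half of [s] turns [8^-1]
    into [4^-1], and lying strictly below [s] yields the mass bound at an atom. *)
Lemma mo_conj_le phi phi1 t (v : R) (M : \bar R) :
  star_shaped (phi t) -> star_shaped (phi1 t) -> (0 <= v)%R -> 0 <= M ->
  (forall k, (atomic_part mu t -> phi1 t (nnrat k) * mu [set t] <= 1) ->
    lreg (phi t) (4^-1 * (nnrat k * v))%R - phi1 t (nnrat k) <= M) ->
  mo_conj mu phi phi1 t (8^-1 * v)%R <= M.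
Proof.
move=> sphi sphi1 v0 M0 h.
suff term s : (0 <= s)%R ->
    (atomic_part mu t -> s%:E <= mo_inv phi1 t (mu [set t])^-1) ->
    phi t (s * (8^-1 * v))%R - phi1 t s <= M.
  rewrite /mo_conj; case: ifPn => [_|/negP nat_t]; apply: ge_ereal_sup => _ [s [s0 sb] <-].
    by apply: term => // _; move: sb; rewrite le_min => /andP[].
  by apply: term => // at_t; exfalso; apply: nat_t; exact/mem_set.
move=> s0 s_atom.
have phi1s := star_ge0 sphi1 s0.
move: v0; rewrite le_eqVlt => /predU1P[<-|v0].
  by rewrite !mulr0 star0// (le_trans _ M0)// -[leRHS](subee (x := 0))// leeB.
move: s0; rewrite le_eqVlt => /predU1P[<-|s0].
  by rewrite mul0r !star0// subee.
have [k /andP[sk ks]] := @nnrat_dense R (s / 2)%R s ltac:(lra) ltac:(lra).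
have k0 := @nnrat_ge0 R k.
apply: le_trans (h k _).
  apply: leeB; last by apply: star_homo => //; exact: ltW.
  apply: le_lreg => //; first by rewrite !mulr_ge0 ?ltW ?invr_gt0.
  by nra.
move=> at_t; rewrite -le_inve//; [|exact: star_ge0|by have [] := at_t].
rewrite leNgt; apply/negP => kM.
have : mo_inv phi1 t (mu [set t])^-1 <= (nnrat k)%:E.
  by apply: ereal_inf_lbound; exists (nnrat k).
by rewrite leNgt (lt_le_trans _ (s_atom at_t))// lte_fin.
Qed.

End conjugate.

(** * Transfer to the original modulars *)

Section bridge.
Context d (T : measurableType d) (R : realType).
Local Open Scope ereal_scope.

Lemma exists_mfun (f : T -> R) : measurable_fun setT f ->
  exists x : {mfun T >-> R}, forall t, x t = f t.
Proof.
move=> mf; pose x : {mfun T >-> R} := HB.pack f (isMeasurableFun.Build _ _ _ _ f mf).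
by exists x.
Qed.

(** On a measurable null set containing the points without the Young property, the identity is a
    star-shaped substitute. *)
Lemma exists_star_integrand (mu : {measure set T -> \bar R}) phi :
  musielak_orlicz_function mu phi ->
  exists2 phi', star_integrand phi' & {ae mu, forall t, phi' t = phi t}.
Proof.
move=> [_ [N [mN N0 sN]] mphi].
exists (fun t => if t \in N then @EFin R else phi t).
  split => [t|u u0].
    case: ifPn => [_|/negP tN]; first exact: star_shaped_EFin.
    apply: young_star_shaped; apply: contrapT => nt; apply: tN; exact/mem_set/sN.
  rewrite (_ : (fun t => _) = fun t => if t \in N then u%:E else phi t u).
    by apply: measurable_patch => //; exact: mphi.
  by apply/funext => t; case: ifPn.
exists N; split => // t /= ht; apply: contrapT => tN; apply: ht.
by rewrite memNset.
Qed.

Variable mu : {measure set T -> \bar R}.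
Local Notation J phi := (modular mu (fun t => lreg (phi t))).
Implicit Types (phi : T -> R -> \bar R) (x y : T -> R).

Lemma lreg_modular_le phi phi' x :
  (forall t u, (0 <= u)%R -> 0 <= phi t u) -> star_integrand phi' ->
  {ae mu, forall t, phi' t = phi t} -> measurable_fun setT x ->
  J phi' x <= modular mu phi x.
Proof.
move=> phi0 sphi phiE mx; apply: le_lower_integral.
- exact: measurable_lreg_norm.
- by move=> t; exact: lreg_norm_ge0.
- by apply: aeW => t; exact: phi0.
- move: phiE; apply: filterS => t <-; apply: lreg_le => //.
  by have [] := sphi.
Qed.

Lemma modular_le_lreg phi phi' x : star_integrand phi' ->
  {ae mu, forall t, phi' t = phi t} -> measurable_fun setT x ->
  modular mu phi x <= J phi' (fun t => 2 * x t)%R.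
Proof.
move=> sphi phiE mx; apply: lower_integral_le.
- by apply: (measurable_lreg_norm (x := fun t => 2 * x t)%R) => //; exact: measurable_funM.
- by move=> t; exact: (lreg_norm_ge0 (fun t => 2 * x t)%R).
- move: phiE; apply: filterS => t <-; rewrite normrM ger0_norm//.
  by apply: le_lreg_scale; rewrite ?ltr1n//; have [] := sphi.
Qed.

(** Young's inequality in integrated form. The conjugate may give a nonmeasurable integrand, so
    additivity is applied to the measurable [maxe 0 (f t - g t)], which is a.e. below the
    conjugate. *)
Lemma lreg_modular_mul_le (phi phi1 phi' phi1' : T -> R -> \bar R) x y :
  star_integrand phi' -> star_integrand phi1' ->
  {ae mu, forall t, phi' t = phi t} -> {ae mu, forall t, phi1' t = phi1 t} ->
  {ae mu, forall t, mo_supp phi1 t} ->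
  measurable_fun setT x -> measurable_fun setT y -> J phi1' x <= 1 ->
  J phi' (fun t => 2^-1 * (x t * y t))%R <=
  J phi1' x + modular mu (mo_conj mu phi phi1) y.
Proof.
move=> sphi sphi1 phiE phi1E supp mx my Jx.
have mxy : measurable_fun setT (fun t => 2^-1 * (x t * y t))%R.
  by apply: measurable_funM => //; exact: measurable_funM.
pose f t := lreg (phi' t) `|2^-1 * (x t * y t)|%R.
pose g t := lreg (phi1' t) `|x t|%R.
have mf : measurable_fun setT f by exact: (measurable_lreg_norm sphi mxy).
have mg : measurable_fun setT g by exact: measurable_lreg_norm.
have f0 t : 0 <= f t by exact: (lreg_norm_ge0 (fun t => 2^-1 * (x t * y t))%R).
have g0 t : 0 <= g t by exact: lreg_norm_ge0.
have mh : measurable_fun setT (fun t => maxe 0 (f t - g t)).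
  by apply: measurable_maxe => //; exact: emeasurable_funB.
have h0 t : 0 <= maxe 0 (f t - g t) by rewrite le_max lexx.
apply: (@le_trans _ _ (\int[mu]_t (g t + maxe 0 (f t - g t)))).
  apply: ge0_le_integral => //.
  - by move=> t _; exact: f0.
  - exact: emeasurable_funD.
  - move=> t _; case: (g t) (g0 t) => [r r0||//].
      by rewrite -leeBlDl// le_max lexx orbT.
    by move=> _; rewrite addye ?leey// gt_eqF// (@lt_le_trans _ _ 0)// le_max lexx.
rewrite ge0_integralD//; apply: leeD => //.
have gfin : {ae mu, forall t, g t < +oo}.
  have /integrable_ae : mu.-integrable setT g.
    apply/integrableP; split => //.
    under eq_integral do rewrite gee0_abs//.
    exact: le_lt_trans Jx (ltry _).
  move=> /(_ measurableT); apply: filterS => t /(_ Logic.I).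
  by rewrite ge0_fin_numE.
(* The mass of [g] at a point is at most its integral, hence at most 1: elements of the unit ball
   respect the truncation. *)
have g_atom t : atomic_part mu t -> g t * mu [set t] <= 1.
  move=> [mt _ _]; apply: le_trans Jx.
  rewrite -integral_cst// (eq_integral g).
    by apply: ge0_subset_integral.
  by move=> u; rewrite inE => ->.
apply: le_lower_integral => //.
  move: supp phiE phi1E; apply: filterS3 => t supp phiE phi1E.
  apply: mo_conj_ge0 => //; first by rewrite -phiE; exact: star_integrandP.
  by rewrite -phi1E; exact: star_integrandP.
have suppg : {ae mu, forall t, mo_supp phi1 t /\ g t < +oo}.
  by move: supp gfin; apply: filterS2.
move: suppg phiE phi1E; apply: filterS3 => t [suppt gt] phiE phi1E.
have sp : star_shaped (phi t) by rewrite -phiE; exact: star_integrandP.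
have sp1 : star_shaped (phi1 t) by rewrite -phi1E; exact: star_integrandP.
rewrite ge_max mo_conj_ge0//=.
rewrite /f /g phiE phi1E !normrM (@ger0_norm _ 2^-1%R) ?invr_ge0//.
by apply: le_mo_conj => //; rewrite -phi1E//; exact: g_atom.
Qed.

End bridge.

Section conjugate_bound.
Context d (T : measurableType d) (R : realType).
Variable mu : {sigma_finite_measure set T -> \bar R}.
Local Open Scope ereal_scope.
Local Notation J phi := (modular mu (fun t => lreg (phi t))).

Lemma mo_conj_modular_le (phi phi1 phi' phi1' : T -> R -> \bar R) (y : T -> R) :
  atoms_are_singletons mu -> star_integrand phi' -> star_integrand phi1' ->
  {ae mu, forall t, phi' t = phi t} -> {ae mu, forall t, phi1' t = phi1 t} ->
  measurable_fun setT y ->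
  (forall x, measurable_fun setT x -> J phi1' x <= 1 ->
     J phi' (fun t => x t * y t)%R <= 1) ->
  modular mu (mo_conj mu phi phi1) (fun t => 8^-1 * y t)%R <= 1.
Proof.
move=> mu_atoms sphi sphi1 phiE phi1E my y_mult.
have [Psi [mPsi Psi0 intPsi hPsi]] := multiplier_dominated mu_atoms sphi sphi1 my y_mult.
apply: le_trans intPsi; apply: lower_integral_le => //.
move: phiE phi1E; apply: filterS2 => t phiE phi1E.
rewrite normrM (@ger0_norm _ 8^-1%R) ?invr_ge0//.
apply: mo_conj_le => //; [by rewrite -phiE; exact: star_integrandP| |].
  by rewrite -phi1E; exact: star_integrandP.
by move=> k; rewrite -phiE -phi1E; exact: hPsi.
Qed.

End conjugate_bound.

(** * Equality of the spaces and equivalence of the norms *)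

Theorem theorem9 (R : realType) (d : measure_display) (T : measurableType d)
    (mu : {sigma_finite_measure set T -> \bar R})
    (mu_complete : measure_is_complete mu)
    (mu_atoms : atoms_are_singletons mu)
    (phi phi1 : T -> R -> \bar R)
    (mo_phi : musielak_orlicz_function mu phi)
    (mo_phi1 : musielak_orlicz_function mu phi1)
    (supp_phi1 : {ae mu, forall t, mo_supp phi1 t}) :
  multipliers (mo_space mu phi1) (mo_space mu phi)
    = mo_space mu (mo_conj mu phi phi1) /\
  equivalent_norms (mo_space mu (mo_conj mu phi phi1))
    (mo_norm mu (mo_conj mu phi phi1))
    (multiplier_norm (mo_space mu phi1) (mo_norm mu phi1) (mo_norm mu phi)).
Proof.
have [psi spsi psiE] := exists_star_integrand mo_phi.
have [psi1 spsi1 psi1E] := exists_star_integrand mo_phi1.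
have phi0 := mo_ge0 mo_phi; have phi10 := mo_ge0 mo_phi1.
pose J (f : T -> R -> \bar R) := modular mu (fun t => lreg (f t)).
have JI (x : T -> R) : measurable_fun setT x -> (J psi x <= modular mu phi x)%E.
  exact: lreg_modular_le.
have JI1 (x : T -> R) : measurable_fun setT x -> (J psi1 x <= modular mu phi1 x)%E.
  exact: lreg_modular_le.
have IJ (x z : T -> R) : measurable_fun setT x -> (forall t, z t = 2 * x t) ->
    (modular mu phi x <= J psi z)%E.
  by move=> mx /funext ->; exact: modular_le_lreg.
have IJ1 (x z : T -> R) : measurable_fun setT x -> (forall t, z t = 2 * x t) ->
    (modular mu phi1 x <= J psi1 z)%E.
  by move=> mx /funext ->; exact: modular_le_lreg.
have J0 x : (0 <= J psi x)%E by exact: lreg_modular_ge0.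
have J10 x : (0 <= J psi1 x)%E by exact: lreg_modular_ge0.
have mZ l (x : T -> R) : measurable_fun setT x -> measurable_fun setT (fun t => l * x t).
  by move=> mx; exact: measurable_funM.
have mM (x y : T -> R) : measurable_fun setT x -> measurable_fun setT y ->
    measurable_fun setT (fun t => x t * y t).
  by move=> mx my; exact: measurable_funM.
have mx (x : {mfun T >-> R}) : measurable_fun setT x by exact: measurable_funP.
have norm_lt (f : T -> R -> \bar R) (x : {mfun T >-> R}) r : (mo_norm mu f x < r%:E)%E ->
    exists l, [/\ 0 < l, l < r & (modular mu f (fun t => (x t / l)%R) <= 1)%E].
  move=> /ereal_inf_lt[_ [l [l0 fl] <-]]; rewrite lte_fin => lr.
  by exists l.
have norm_le (f : T -> R -> \bar R) (x : {mfun T >-> R}) l : 0 < l ->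
    (modular mu f (fun t => (x t / l)%R) <= 1)%E -> (mo_norm mu f x <= l%:E)%E.
  by move=> l0 fl; apply: ereal_inf_lbound; exists l.
split.
  apply/seteqP; split => y.
    move=> y_mult.
    (* Finiteness of [J psi1 x] places [x / 2] under the original modular, so [x] is a legitimate
       test function for [y_mult]. *)
    have [x mx' Jx|K K0 hK] := gliding_hump (mu := mu) spsi spsi1 (mx y).
      have [z zE] := exists_mfun mx'.
      have [|l l0 hl] := y_mult z.
        exists 2^-1; first by rewrite invr_gt0.
        apply: le_lt_trans Jx; apply: IJ1; first exact: mZ.
        by move=> t; rewrite zE mulVKf.
      exists l => //; apply: le_lt_trans hl.
      rewrite (_ : (fun t => l * (x t * y t)) = fun t => l * (z * y)%R t).
        by apply: JI; exact: mZ.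
      by apply/funext => t; rewrite -zE.
    exists (8^-1 / K); first by rewrite divr_gt0// invr_gt0.
    rewrite (_ : (fun t => _) = fun t => 8^-1 * (y t / K)); last by apply/funext => t; lra.
    apply: le_lt_trans (ltry 1).
    apply: (mo_conj_modular_le mu_atoms spsi spsi1 psiE psi1E) => //.
    exact: measurable_funM.
  move=> [l l0 hl] x [l1 l10 hl1].
  have cfin : (J psi1 (fun t => (l1 * x t)%R) < +oo)%E.
    by apply: le_lt_trans hl1; apply: JI1; exact: mZ.
  pose c := fine (J psi1 (fun t => (l1 * x t)%R)).
  have c0 : 0 <= c by exact: fine_ge0.
  have cE : J psi1 (fun t => (l1 * x t)%R) = c%:E by rewrite fineK// ge0_fin_numE.
  have r01 : 0 <= (1 + c)^-1 <= 1 by rewrite invr_ge0 invf_le1; lra.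
  have r0 : 0 < (1 + c)^-1 by rewrite invr_gt0; lra.
  (* Star-shapedness brings [x] into the unit ball, as [c / (1 + c) <= 1]; the summand 1 covers
     [c = 0]. *)
  pose w t := (1 + c)^-1 * (l1 * x t).
  have mw : measurable_fun setT w by exact/mZ/mZ.
  have Jw : (J psi1 w <= 1)%E.
    apply: (@le_trans _ _ ((1 + c)^-1%:E * c%:E)%E).
      by rewrite -cE; apply: lreg_modular_scale => //; exact: mZ.
    by rewrite -EFinM lee_fin mulrC ler_pdivrMr; lra.
  have := lreg_modular_mul_le spsi spsi1 psiE psi1E supp_phi1 mw (mZ l _ (mx y)) Jw.
  set B := (_ + _)%E => JB.
  have Bfin : (B < +oo)%E by rewrite /B lte_add_pinfty// (le_lt_trans Jw)// ltry.
  (* One factor [2^-1] comes from Young's inequality, the other from undoing the regularization. *)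
  exists (2^-1 * (2^-1 * ((1 + c)^-1 * l1 * l))).
    by rewrite !mulr_gt0// invr_gt0.
  apply: le_lt_trans Bfin; apply: le_trans JB; apply: IJ.
    exact: mZ.
  move=> t; rewrite /w (_ : (x * y)%R t = x t * y t)//.
  by move: ((1 + c)^-1) => k; field.
(* For the lower bound, 16 is 8 from [mo_conj_modular_le] times 2 from [half_ball]. For the upper
   bound it is a factor 2 each for [r < 2], Young's inequality, lowering a modular from 2 to 1, and
   the regularization. *)
exists 16^-1, 16; split; [lra|lra|] => y yconj; split.
  set m := multiplier_norm _ _ _ y.
  have m_ge (x : {mfun T >-> R}) : mo_space mu phi1 x -> (mo_norm mu phi1 x <= 1)%E ->
      (mo_norm mu phi (x * y)%R <= m)%E.
    by move=> xX xn; apply: ereal_sup_ubound; exists x.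
  have half_ball (x : T -> R) : measurable_fun setT x -> (J psi1 x <= 1)%E ->
      exists z : {mfun T >-> R}, [/\ forall t, z t = 2^-1 * x t,
        mo_space mu phi1 z & (mo_norm mu phi1 z <= 1)%E].
    move=> mx' Jx; have [z zE] := exists_mfun (mZ 2^-1 _ mx').
    have Iz (l : R) : l = 1 -> (modular mu phi1 (fun t => (l * z t)%R) <= 1)%E.
      move=> ->; apply: le_trans Jx; apply: IJ1; first exact: mZ.
      by move=> t; rewrite zE; lra.
    exists z; split => //.
      by exists 1 => //; exact: le_lt_trans (Iz 1 erefl) (ltry 1).
    apply: norm_le => //; rewrite (_ : (fun t => _) = fun t => 1 * z t); first exact: Iz.
    by apply/funext => t; rewrite divr1 mul1r.
  have norm0 (f : T -> R -> \bar R) (x : {mfun T >-> R}) : (0 <= mo_norm mu f x)%E.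
    by apply: le_ereal_inf_tmp => _ [l [l0 _] <-]; rewrite lee_fin ltW.
  have m0 : (0 <= m)%E.
    (* The zero function belongs to the unit ball, so the supremum [m] is over a nonempty set. *)
    have [//||z [_ zX zn]] := half_ball (cst 0).
      rewrite (_ : J psi1 (cst 0) = 0%E) ?lee01//.
      apply: integral0_eq => t _; rewrite normr0 lreg0// => u.
      exact/star_ge0/star_integrandP.
    exact: le_trans (norm0 _ _) (m_ge _ zX zn).
  (* The infimum defining the norm of [z * y] may not be attained; any [r > m] leaves room for an
     admissible [l < r]. *)
  have bound (r : R) : (m < r%:E)%E ->
      (mo_norm mu (mo_conj mu phi phi1) y <= (16 * r)%:E)%E.
    move=> mr; have r0 : 0 < r by rewrite -lte_fin (le_lt_trans m0).
    apply: norm_le; first by rewrite mulr_gt0.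
    rewrite (_ : (fun t => _) = fun t => 8^-1 * ((2 * r)^-1 * y t)); last first.
      by apply/funext => t; field; rewrite gt_eqF.
    apply: (mo_conj_modular_le mu_atoms spsi spsi1 psiE psi1E); first exact: mZ.
    move=> x mx' Jx; have [z [zE zX zn]] := half_ball x mx' Jx.
    have [l [l0 lr hl]] := norm_lt _ _ _ (le_lt_trans (m_ge z zX zn) mr).
    apply: le_trans hl.
    rewrite (_ : (fun t => (z * y)%R t / l) =
      fun t => l^-1 * (2^-1 * x t * y t)); last first.
      by apply/funext => t; rewrite -zE mulrC.
    apply: le_trans (JI _ _); last by apply/mZ/mM => //; exact/mZ.
    apply: le_lreg_modular => //.
    - by apply/mM => //; exact/mZ.
    - by apply/mZ/mM => //; exact/mZ.
    - apply: aeW => t.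
      rewrite (_ : x t * ((2 * r)^-1 * y t) = r^-1 * (2^-1 * x t * y t)); last first.
        by field; rewrite gt_eqF.
      rewrite !(normrM _^-1) ler_wpM2r// !gtr0_norm ?invr_gt0//.
      by rewrite lef_pV2 ?posrE// ltW.
  (* For infinite [m] the bound is trivial; otherwise [r] decreases to [m]. *)
  clear m_ge; clearbody m; case: m m0 bound => [m||//] m0 bound; last by rewrite leey.
  rewrite muleC -lee_pdivlMr; last by rewrite invr_gt0.
  rewrite invrK -EFinM; apply/lee_addgt0Pr => e e0.
  apply: le_trans (bound (m + e / 16) _) _.
    by rewrite lte_fin ltrDl divr_gt0.
  by rewrite -EFinD lee_fin; lra.
apply: ge_ereal_sup => _ [x [xX xn] <-].
rewrite muleC -lee_pdivrMr//.
apply: le_ereal_inf_tmp => _ [l [l0 hl] <-].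
rewrite lee_pdivrMr// -EFinM.
apply: norm_le; first by rewrite mulr_gt0.
(* A norm of at most 1 yields admissible radii only above 1; any below 2 suffices, since [x] is
   halved next. *)
have [r [r0 r2 hr]] : exists r,
    [/\ 0 < r, r < 2 & (modular mu phi1 (fun t => (x t / r)%R) <= 1)%E].
  by apply: norm_lt; apply: le_lt_trans xn _; rewrite lte_fin ltr1n.
have mx2 : measurable_fun setT (fun t => 2^-1 * x t) by exact: mZ.
have my : measurable_fun setT (fun t => l^-1 * y t) by exact: mZ.
have Jx : (J psi1 (fun t => (2^-1 * x t)%R) <= 1)%E.
  rewrite (_ : (fun t => x t / r) = fun t => r^-1 * x t) in hr; last first.
    by apply/funext => t; rewrite mulrC.
  apply: le_trans hr; apply: le_trans (JI1 _ (mZ _ _ (mx x))).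
  apply: le_lreg_modular => //; first exact: mZ.
  apply: aeW => t; rewrite !normrM ler_wpM2r// !gtr0_norm ?invr_gt0//.
  by rewrite lef_pV2 ?posrE// ltW.
pose w t := 2^-1 * (2^-1 * x t * (l^-1 * y t)).
have mw : measurable_fun setT w by exact/mZ/mM.
have Jw : (J psi w <= 2%:E)%E.
  apply: le_trans (lreg_modular_mul_le spsi spsi1 psiE psi1E supp_phi1 mx2 my Jx) _.
  rewrite (_ : 2%:E = 1 + 1)%E; last by rewrite -EFinD.
  apply: leeD => //; rewrite (_ : (fun t => _) = fun t => y t / l)//.
  by apply/funext => t; rewrite mulrC.
have h01 : 0 <= (2^-1 : R) <= 1 by rewrite invr_ge0 ler0n invf_le1 ?ler1n.
apply: le_trans (IJ _ (fun t => 2^-1 * w t) _ _) _.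
- rewrite (_ : (fun t => _) = fun t => (l * 16)^-1 * (x * y)%R t); last first.
    by apply/funext => t; rewrite mulrC.
  exact: mZ.
- move=> t; rewrite /w (_ : (x * y)%R t = x t * y t)//; field.
  by rewrite gt_eqF.
apply: (@le_trans _ _ (2^-1%:E * 2%:E)%E); last by rewrite -EFinM mulVf.
apply: le_trans (lreg_modular_scale _ spsi h01 mw) _.
by rewrite lee_wpmul2l// lee_fin; have /andP[] := h01.
Qed.
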